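(* Let $\kappa, s_1, s_2\in\mathbb{R}$, let $1<p_1<\infty$, $1<p_2<\infty$, and let $q_1$ be defined by $1/p_1+1/q_1=1$. Let $K(x,y)$ be a measurable kernel on $\mathbb{R}\times\mathbb{R}$ satisfying $|K(x,y)|\sim(1+|x|+|y|)^{-\kappa}$. Suppose $s_1<0$ and $\kappa>\max\{1/q_1-2s_1/p_1,\ 1/p_2+1/q_1+2s_2/p_2-2s_1/p_1\}$. Then the integral operator $(Kf)(x)=\int_{-\infty}^{+\infty}K(x,y)f(y)\,dy$ is a bounded linear operator $K: H^{p_1,s_1}(\mathbb{R})\rightarrow H^{p_2,s_2}(\mathbb{R})$.
   Context: For $s\in\mathbb{R}$ and $1<p<\infty$, $H^{p,s}(\mathbb{R})$ denotes here the weighted space of (classes of a.e. equal) measurable functions $f:\mathbb{R}\to\mathbb{C}$ with finite norm $\|f\|_{p,s}=\left(\int_{\mathbb{R}}|f(x)|^p(1+|x|)^{2s}\,dx\right)^{1/p}$ (no Fourier transform is taken in this norm; the weight exponent is $2s$, independent of $p$). The relation $|K(x,y)|\sim(1+|x|+|y|)^{-\kappa}$ means that there are constants $c_1,c_2>0$ with $c_1(1+|x|+|y|)^{-\kappa}\le|K(x,y)|\le c_2(1+|x|+|y|)^{-\kappa}$ for all $x,y\in\mathbb{R}$. *)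

(* Defs.v *)
From HB Require Import structures.
From mathcomp Require Import all_boot all_order all_algebra.
From mathcomp Require Import generic_quotient ring_quotient.
From mathcomp Require Import complex.
From mathcomp Require Import all_classical all_reals all_analysis.
From mathcomp Require Import measurable_realfun.

Set Implicit Arguments.
Unset Strict Implicit.
Unset Printing Implicit Defensive.
Import Order.TTheory GRing.Theory Num.Theory.
Import numFieldNormedType.Exports.
Import ComplexField.Normc.

Local Open Scope classical_set_scope.
Local Open Scope ring_scope.

(* The real line carrying its Lebesgue sigma-algebra, the completion of the
   Borel sigma-algebra. *)
Definition lebesgueType (R : realType) : Type :=
  caratheodory_type ((@wlength R idfun)^*)%mu.
HB.instance Definition _ (R : realType) := Measurable.on (lebesgueType R).

Definition leb {R : realType} : set (lebesgueType R) -> \bar R :=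
  completed_lebesgue_measure.
HB.instance Definition _ (R : realType) := Measure.on (@leb R).
HB.instance Definition _ (R : realType) := SigmaFiniteMeasure.on (@leb R).

Section ComplexValued.
Context d (T : measurableType d) (R : realType).
Implicit Types (mu : {measure set T -> \bar R}) (f : T -> R[i]).

Definition cmeasurable_fun f :=
  measurable_fun [set: T] (fun x => complex.Re (f x)) /\
  measurable_fun [set: T] (fun x => complex.Im (f x)).

Definition cintegrable mu f :=
  mu.-integrable [set: T] (fun x => (complex.Re (f x))%:E) /\
  mu.-integrable [set: T] (fun x => (complex.Im (f x))%:E).

Definition cintegral mu f : R[i] :=
  Complex (\int[mu]_x complex.Re (f x)) (\int[mu]_x complex.Im (f x)).

Lemma cmeasurable_funD f g :
  cmeasurable_fun f -> cmeasurable_fun g -> cmeasurable_fun (f + g).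
Proof.
move=> [mrf mif] [mrg mig]; split.
- rewrite [X in measurable_fun _ X](_ : _ =
    (fun x => complex.Re (f x)) \+ (fun x => complex.Re (g x))).
    exact: measurable_funD.
  by apply/funext => x; rewrite fctE/=; case: (f x); case: (g x).
- rewrite [X in measurable_fun _ X](_ : _ =
    (fun x => complex.Im (f x)) \+ (fun x => complex.Im (g x))).
    exact: measurable_funD.
  by apply/funext => x; rewrite fctE/=; case: (f x); case: (g x).
Qed.

Lemma cmeasurable_funZ (a : R[i]) f :
  cmeasurable_fun f -> cmeasurable_fun (a *: f).
Proof.
case: a => a b [mrf mif]; split.
- rewrite [X in measurable_fun _ X](_ : _ =
    (fun x => a * complex.Re (f x) - b * complex.Im (f x))).
    by apply: measurable_funB; apply: measurable_funM => //; exact: measurable_cst.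
  by apply/funext => x; rewrite fctE; case: (f x).
- rewrite [X in measurable_fun _ X](_ : _ =
    (fun x => a * complex.Im (f x) + b * complex.Re (f x))).
    by apply: measurable_funD; apply: measurable_funM => //; exact: measurable_cst.
  by apply/funext => x; rewrite fctE; case: (f x) => c e /=; rewrite addrC.
Qed.

Lemma cmeasurable_fun0 : cmeasurable_fun (0 : T -> R[i]).
Proof. by split; exact: measurable_cst. Qed.

Lemma measurable_normc f :
  cmeasurable_fun f -> measurable_fun [set: T] (fun x => normc (f x)).
Proof.
move=> [mrf mif].
rewrite [X in measurable_fun _ X](_ : _ = (fun x =>
  Num.sqrt (complex.Re (f x) ^+ 2 + complex.Im (f x) ^+ 2))).
  apply: (measurableT_comp (continuous_measurable_fun (@sqrt_continuous R))).
  by apply: measurable_funD; exact: measurable_funX.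
by apply/funext => x; case: (f x).
Qed.

End ComplexValued.

Section WeightedNorm.
Context d (T : measurableType d) (R : realType).
Variables (mu : {measure set T -> \bar R}) (w : T -> R) (p : R).
Implicit Types f g : T -> R[i].

Definition wnorm f : \bar R :=
  (\int[mu]_x (normc (f x) `^ p * w x)%:E) `^ p^-1.

Definition wLfun : {pred T -> R[i]} :=
  mem [set f | cmeasurable_fun f /\ (wnorm f < +oo)%E].

Hypotheses (mw : measurable_fun [set: T] w) (w_gt0 : forall x, 0 < w x).
Hypothesis p1 : 1 < p.

Let wmod f (x : T) : R := normc (f x) * w x `^ p^-1.

Let p0 : 0 < p. Proof. exact: lt_trans p1. Qed.

Let normc_ge0 (z : R[i]) : 0 <= normc z.
Proof. by case: z => a b; exact: sqrtr_ge0. Qed.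

Let wmod_ge0 f x : 0 <= wmod f x.
Proof. by rewrite mulr_ge0// powR_ge0. Qed.

Let wmodE f x : normc (f x) `^ p * w x = wmod f x `^ p.
Proof.
rewrite powRM ?powR_ge0// -powRrM mulVf ?powRr1//; first exact: ltW.
by rewrite gt_eqF.
Qed.

Let wnormE f : wnorm f = 'N[mu]_p%:E[EFin \o wmod f]%E.
Proof.
rewrite unlock /wnorm /=; congr (_ `^ _)%E; apply: eq_integral => x _ /=.
by rewrite wmodE ger0_norm.
Qed.

Let measurable_wmod f :
  cmeasurable_fun f -> measurable_fun [set: T] (wmod f).
Proof.
move=> mf; apply: measurable_funM; first exact: measurable_normc.
exact: (measurableT_comp (measurable_powR _)).
Qed.

Let measurable_wmodX f : cmeasurable_fun f ->
  measurable_fun [set: T] (fun x => (normc (f x) `^ p * w x)%:E).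
Proof.
move=> mf; apply/measurable_EFinP; apply: measurable_funM => //.
by apply: (measurableT_comp (measurable_powR _)); exact: measurable_normc.
Qed.

Let integrand_ge0 f x : (0 <= (normc (f x) `^ p * w x)%:E)%E.
Proof. by rewrite lee_fin mulr_ge0 ?powR_ge0// ltW. Qed.

Lemma wnorm_ge0 f : (0 <= wnorm f)%E.
Proof. exact: poweR_ge0. Qed.

Lemma wnormD f g : cmeasurable_fun f -> cmeasurable_fun g ->
  (wnorm (f + g)%R <= wnorm f + wnorm g)%E.
Proof.
move=> mf mg; rewrite (wnormE f) (wnormE g).
apply: le_trans (eminkowski _ _ _ _); last 3 first.
- exact: measurable_wmod.
- exact: measurable_wmod.
- by rewrite lee_fin ltW.
rewrite unlock /wnorm /Lnorm; apply: gt0_ler_poweR.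
- by rewrite invr_ge0 ltW.
- by rewrite in_itv/= leey andbT integral_ge0.
- by rewrite in_itv/= leey andbT integral_ge0// => x _; exact: poweR_ge0.
apply: ge0_le_integral => //=.
- by apply: measurable_wmodX; exact: cmeasurable_funD.
- apply/measurable_EFinP/(measurableT_comp (measurable_powR _)).
  apply: (measurableT_comp (@normr_measurable R setT)).
  by apply: measurable_funD; exact: measurable_wmod.
- move=> x _; rewrite lee_fin wmodE ge0_ler_powR ?nnegrE ?(ltW p0)//.
  rewrite ger0_norm ?addr_ge0// /wmod -mulrDl ler_wpM2r ?powR_ge0//.
  exact: le_normcD.
Qed.

Lemma wnormZ (a : R[i]) f : cmeasurable_fun f ->
  (wnorm (a *: f)%R = (normc a)%:E * wnorm f)%E.
Proof.
move=> mf; rewrite /wnorm.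
under eq_integral => x _.
  rewrite [normc _](_ : _ = normc a * normc (f x)); last exact: normcM.
  rewrite powRM// -mulrA EFinM.
  over.
rewrite ge0_integralZl//; last 2 first.
- exact: measurable_wmodX.
- by rewrite lee_fin powR_ge0.
rewrite poweRM ?lee_fin ?powR_ge0// ?integral_ge0//.
by rewrite poweR_EFin -powRrM mulfV ?gt_eqF// powRr1.
Qed.

Lemma wnorm_eq0 f : cmeasurable_fun f ->
  wnorm f = 0 <-> {ae mu, forall x, f x = 0}.
Proof.
move=> mf; rewrite wnormE; split.
- move=> /Lnorm_eq0_eq0 h.
  have /h : measurable_fun [set: T] (EFin \o wmod f).
    by apply/measurable_EFinP; exact: measurable_wmod.
  move=> /(_ p0); apply: filterS => x /(_ I) [] /eqP.
  rewrite /wmod mulf_eq0 (gt_eqF (powR_gt0 _ _))// orbF => /eqP.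
  exact: eq0_normc.
- move=> f0; rewrite unlock /Lnorm (ae_eq_integral (cst 0))//=.
  + by rewrite integral0 poweR0r// invr_neq0// gt_eqF.
  + apply/measurable_EFinP/(measurableT_comp (measurable_powR _)).
    apply: (measurableT_comp (@normr_measurable R setT)).
    exact: measurable_wmod.
  + move: f0; apply: filterS => x /= fx0 _.
    by rewrite /wmod fx0 normc0 mul0r normr0 powR0// gt_eqF.
Qed.

Lemma wLfunP f : f \in wLfun <-> cmeasurable_fun f /\ (wnorm f < +oo)%E.
Proof. by split=> [/set_mem|/mem_set]. Qed.

Lemma wLfun_submod_closed : submod_closed wLfun.
Proof.
split.
  apply/wLfunP; split; first exact: cmeasurable_fun0.
  have [_ ->] := wnorm_eq0 (@cmeasurable_fun0 _ T R); first exact: ltry.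
  by apply: aeW => x.
move=> a f g /wLfunP[mf ff] /wLfunP[mg fg].
have maf := cmeasurable_funZ a mf.
apply/wLfunP; split; first exact: cmeasurable_funD.
apply: (le_lt_trans (wnormD maf mg)).
apply: lte_add_pinfty fg; rewrite wnormZ//.
by apply: lte_mul_pinfty ff; [rewrite lee_fin; exact: normc_ge0|].
Qed.

End WeightedNorm.

Section WeightedSpace.
Context d (T : measurableType d) (R : realType).
Variables (mu : {measure set T -> \bar R}) (w : T -> R) (p : R).
Variables (mw : measurable_fun [set: T] w) (w_gt0 : forall x, 0 < w x).
Variable p1 : 1 < p.

(* The proofs are parameters of the type because its vector space structure
   depends on them. *)
Definition wLfun_of of measurable_fun [set: T] w & (forall x, 0 < w x) & 1 < p
  : {pred T -> R[i]} := wLfun mu w p.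
Local Notation wLf := (wLfun_of mw w_gt0 p1).

Record wLfunType := WLfun { wLfun_fun :> T -> R[i] ; _ : wLfun_fun \in wLf }.

HB.instance Definition _ := [isSub for wLfun_fun].
HB.instance Definition _ := [Choice of wLfunType by <:].
HB.instance Definition _ := GRing.isSubmodClosed.Build _ _ wLf
  (wLfun_submod_closed mu mw w_gt0 p1).
HB.instance Definition _ := [SubChoice_isSubLmodule of wLfunType by <:].

Definition ae_null : {pred wLfunType} :=
  mem [set f : wLfunType | {ae mu, forall x, f x = 0}].

Lemma ae_nullP (f : wLfunType) : f \in ae_null <-> {ae mu, forall x, f x = 0}.
Proof. by split=> [/set_mem|/mem_set]. Qed.

Lemma ae_null_zmod_closed : zmod_closed ae_null.
Proof.
split; first by apply/ae_nullP; apply: aeW => x.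
move=> f g /ae_nullP f0 /ae_nullP g0; apply/ae_nullP.
apply: filterS2 f0 g0 => x fx gx.
by rewrite -[LHS]/(f x - g x) fx gx subr0.
Qed.

HB.instance Definition _ := GRing.isZmodClosed.Build _ ae_null
  ae_null_zmod_closed.

Definition wLspace : Type := Quotient.quot ae_null.
HB.instance Definition _ := GRing.Zmodule.on wLspace.
HB.instance Definition _ := ZmodQuotient.on wLspace.

Local Open Scope quotient_scope.

Definition wLclass (f : wLfunType) : wLspace := \pi_wLspace f.

Let wLspaceW (P : wLspace -> Prop) : (forall f, P (wLclass f)) -> forall u, P u.
Proof. by move=> Pf; elim/quotW. Qed.

Lemma wLclass_eqP (f g : wLfunType) :
  wLclass f = wLclass g <-> {ae mu, forall x, f x = g x}.
Proof.
have -> : (wLclass f = wLclass g) <-> (f - g \in ae_null).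
  by rewrite Quotient.idealrBE; split=> [/eqP|/eqP].
rewrite ae_nullP; split; apply: filterS => x.
- by rewrite -[LHS]/(f x - g x) => /eqP; rewrite subr_eq0 => /eqP.
- by move=> fg; rewrite -[LHS]/(f x - g x) fg subrr.
Qed.

Lemma wLclassD (f g : wLfunType) : wLclass (f + g) = wLclass f + wLclass g.
Proof. exact: (@pi_addr _ _ _ _ _ wLspace). Qed.

Lemma wLclass0 : wLclass 0 = 0.
Proof. exact: (@pi_zeror _ _ _ _ _ wLspace). Qed.

Definition wLspace_scale (a : R[i]) (u : wLspace) : wLspace :=
  wLclass (a *: repr u).

Let repr_class f : {ae mu, forall x, (repr (wLclass f) : wLfunType) x = f x}.
Proof. by apply/wLclass_eqP; exact: reprK. Qed.

Let scale_class a (f : wLfunType) :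
  wLspace_scale a (wLclass f) = wLclass (a *: f).
Proof.
apply/wLclass_eqP; apply: filterS (repr_class f) => x fx.
by rewrite -[LHS]/(a *: ((repr (wLclass f) : wLfunType) x)) fx.
Qed.

Let scaleA a b u :
  wLspace_scale a (wLspace_scale b u) = wLspace_scale (a * b) u.
Proof.
by elim/wLspaceW: u => f; rewrite (scale_class b) !(scale_class _) scalerA.
Qed.

Let scale1 : left_id 1 wLspace_scale.
Proof. by elim/wLspaceW => f; rewrite scale_class scale1r. Qed.

Let scaleDr : right_distributive wLspace_scale +%R.
Proof.
move=> a; elim/wLspaceW => f; elim/wLspaceW => g.
by rewrite -wLclassD (scale_class _ f) (scale_class _ g) scale_class -wLclassD
  scalerDr.
Qed.

Let scaleDl u : {morph wLspace_scale^~ u : a b / a + b}.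
Proof.
by move=> a b; elim/wLspaceW: u => f; rewrite !(scale_class _ f) scalerDl wLclassD.
Qed.

HB.instance Definition _ := GRing.Zmodule_isLmodule.Build R[i] wLspace
  scaleA scale1 scaleDr scaleDl.

Lemma wLclassZ (a : R[i]) (f : wLfunType) : wLclass (a *: f) = a *: wLclass f.
Proof. exact/esym/scale_class. Qed.

Definition wLspace_norm (u : wLspace) : R := fine (wnorm mu w p (repr u)).

Lemma wLfun_valP (f : wLfunType) :
  cmeasurable_fun f /\ (wnorm mu w p f < +oo)%E.
Proof. exact/wLfunP/(valP f). Qed.

Lemma wnorm_fin (f : wLfunType) : wnorm mu w p f \is a fin_num.
Proof.
by have [_ ?] := wLfun_valP f; rewrite ge0_fin_numE//; exact: wnorm_ge0.
Qed.

Let cmeasurable_wLfun (f : wLfunType) : cmeasurable_fun f.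
Proof. by have [] := wLfun_valP f. Qed.

Let wnorm_wLfunD (f g : wLfunType) :
  (wnorm mu w p (f + g)%R <= wnorm mu w p f + wnorm mu w p g)%E.
Proof. exact: wnormD. Qed.

Let wnorm_wLfunZ a (f : wLfunType) :
  (wnorm mu w p (a *: f)%R = (normc a)%:E * wnorm mu w p f)%E.
Proof. exact: wnormZ. Qed.

Lemma wLspace_norm_class (f : wLfunType) :
  wLspace_norm (wLclass f) = fine (wnorm mu w p f).
Proof.
rewrite /wLspace_norm; suff -> : wnorm mu w p (repr (wLclass f)) = wnorm mu w p f by [].
rewrite /wnorm; apply: (congr1 (poweR ^~ p^-1)).
have mX (g : wLfunType) :
    measurable_fun [set: T] (fun x => (normc (g x) `^ p * w x)%:E).
  apply/measurable_EFinP; apply: measurable_funM => //.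
  apply: (measurableT_comp (measurable_powR _)).
  exact: measurable_normc.
apply: ae_eq_integral => //.
by apply: filterS (repr_class f) => x fx _; rewrite fx.
Qed.

Let ler_wLspace_normD u v :
  wLspace_norm (u + v) <= wLspace_norm u + wLspace_norm v.
Proof.
elim/wLspaceW: u => f; elim/wLspaceW: v => g.
rewrite -wLclassD !wLspace_norm_class -fineD; do ?exact: wnorm_fin.
apply: fine_le; [exact: wnorm_fin| |exact: wnorm_wLfunD].
by rewrite fin_numD; apply/andP; split; exact: wnorm_fin.
Qed.

Let wLspace_norm_eq0 u : wLspace_norm u = 0 -> u = 0.
Proof.
elim/wLspaceW: u => f; rewrite wLspace_norm_class => f0.
have {}f0 : wnorm mu w p f = 0 by rewrite -(fineK (wnorm_fin f)) f0.
rewrite -wLclass0; apply/wLclass_eqP.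
by apply/(wnorm_eq0 mu mw w_gt0 p1).
Qed.

Lemma wLspace_normZ (a : R[i]) u :
  wLspace_norm (a *: u) = normc a * wLspace_norm u.
Proof.
elim/wLspaceW: u => f.
rewrite -wLclassZ !wLspace_norm_class wnorm_wLfunZ fineM //; exact: wnorm_fin.
Qed.

Let wLspace_normMn u n : wLspace_norm (u *+ n) = wLspace_norm u *+ n.
Proof.
rewrite -scaler_nat wLspace_normZ -[in RHS]mulr_natl; congr (_ * _).
rewrite (_ : n%:R = (n%:R)%:C%C :> R[i]); last by rewrite rmorph_nat.
by rewrite /= expr0n/= addr0 sqrtr_sqr ger0_norm.
Qed.

Let wLspace_normN u : wLspace_norm (- u) = wLspace_norm u.
Proof.
by rewrite -scaleN1r wLspace_normZ (@normcN R (1 : R[i])) normc1 mul1r.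
Qed.

HB.instance Definition _ := Num.Zmodule_isNormed.Build R wLspace
  ler_wLspace_normD wLspace_norm_eq0 wLspace_normMn wLspace_normN.

Definition represents (f : T -> R[i]) (u : wLspace) : Prop :=
  exists2 g : wLfunType, wLfun_fun g = f & wLclass g = u.

End WeightedSpace.

Section Hspace.
Context {R : realType}.
Local Notation L := (lebesgueType R).

Definition Hweight (s : R) (x : L) : R := (1 + `|x : R|) `^ (2 * s).

Lemma measurable_Hweight s : measurable_fun [set: L] (Hweight s).
Proof.
have mid : measurable_fun [set: L] (fun x : L => x : R).
  by move=> _ B mB; rewrite setTI preimage_id; exact: sub_caratheodory.
apply: (measurableT_comp (measurable_powR _)).
apply: measurable_funD; first exact: measurable_cst.
exact: (measurableT_comp (@normr_measurable R setT) mid).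
Qed.

Lemma Hweight_gt0 s x : 0 < Hweight s x.
Proof. by rewrite powR_gt0// ltr_pwDl. Qed.

Definition Hspace (p : R) (p1 : 1 < p) (s : R) : Type :=
  wLspace leb (measurable_Hweight s) (Hweight_gt0 s) p1.
HB.instance Definition _ (p : R) (p1 : 1 < p) s := GRing.Lmodule.on (Hspace p1 s).
HB.instance Definition _ (p : R) (p1 : 1 < p) s :=
  Num.NormedZmodule.on (Hspace p1 s).

End Hspace.

Section Kernel.
Context {R : realType}.
Local Notation L := (lebesgueType R).
Implicit Types K : R -> R -> R[i].

(* Lebesgue measurability on the plane: preimages of Borel sets belong to the
   completion of the product sigma-algebra. *)
Definition lebesgue_measurable_kernel K := forall B : set R, measurable B ->
  completed_algebra_gen (@leb R \x @leb R)%E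
    [set z : L * L | B (complex.Re (K z.1 z.2))] /\
  completed_algebra_gen (@leb R \x @leb R)%E
    [set z : L * L | B (complex.Im (K z.1 z.2))].

Definition kernel_sim K (kappa : R) := exists c1 c2 : R,
  [/\ 0 < c1, 0 < c2 & forall x y : R,
    c1 * (1 + `|x| + `|y|) `^ (- kappa) <= normc (K x y) /\
    normc (K x y) <= c2 * (1 + `|x| + `|y|) `^ (- kappa)].

(* Meaningful at x only when K x * f is integrable; cintegral is total. *)
Definition integral_operator K (f : L -> R[i]) : L -> R[i] :=
  fun x => cintegral leb (fun y : L => K x y * f y).

End Kernel.

(* Main.v *)
(** With [a = kappa + 2 s1 / p1], choose [b] strictly between [1 / q1] and
   [min (a, a - 1 / p2 - 2 s2 / p2)] and put [alpha = a - b],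
   [beta = b - 2 s1 / p1]. Then [kappa = alpha + beta] with [alpha, beta >= 0],
   so the kernel is dominated by the rank-one kernel
   [c2 (1 + |x|)^-alpha (1 + |y|)^-beta]. Hoelder's inequality in [y] bounds
   [|Kf(x)|] by a multiple of [(1 + |x|)^-alpha ||f||], because [b q1 > 1], and
   [(1 + |x|)^-alpha] lies in the target space, because
   [alpha p2 - 2 s2 > 1]. The kernel is only measurable for the completion of
   the product sigma-algebra: it agrees almost everywhere with a
   product-measurable kernel, to which Fubini's theorem applies, and
   completeness of the measures transfers measurability back. *)

Require Import Defs.
From HB Require Import structures.
From mathcomp Require Import all_boot all_order all_algebra.
From mathcomp Require Import complex.
From mathcomp Require Import all_classical all_reals all_analysis.
From mathcomp Require Import measurable_realfun generic_quotient ring lra.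
Set Implicit Arguments.
Unset Strict Implicit.
Import Order.TTheory GRing.Theory Num.Theory.
Import numFieldNormedType.Exports.
Import ComplexField.Normc.
Local Open Scope classical_set_scope.
Local Open Scope ring_scope.

(** * Completed measures and null sets of a product *)

(** Rational levels are countably many, so the negligible parts of the corresponding superlevel sets
    of [h] fit into one measurable null set [M]. Resetting [h] to 0 on [M] gives [g]. *)
Lemma completed_measurable_fun_ae d (T : measurableType d) (R : realType)
    (mu : {measure set T -> \bar R}) (h : T -> R) :
  (forall B, measurable B -> completed_algebra_gen mu (h @^-1` B)) ->
  exists2 g : T -> R, measurable_fun [set: T] g &
    {ae mu, forall x, g x = h x}.
Proof.
move=> mh.
(* [r n] ranges over the rationals. *)
pose r n : R := ratr (odflt 0 (unpickle n : option rat)).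
have /choice[A /choice[N AN]] n : exists A N,
    [/\ measurable A, mu.-negligible N & A `|` N = h @^-1` `]r n, +oo[%classic].
  have [|A mA [N nN AN]] := mh `]r n, +oo[%classic; last by exists A, N.
  exact: measurable_itv.
have [M [mM M0 NM]] : mu.-negligible (\bigcup_n N n).
  by apply: negligible_bigcup => n; have [] := AN n.
exists (h \_ (~` M)).
  apply/(measurable_restrict h (measurableC mM) measurableT); rewrite setTI.
  apply: (measurability _ (RGenOInfty.measurableE R)) => // _ [_ [x ->] <-].
  (* A rational between [x] and [h t] makes the superlevel set a countable union, and off [M] the
     preimage of []r n, +oo[] reduces to its measurable part [A n]. *)
  rewrite (_ : _ `&` _ =
      \bigcup_(n in [set n | x < r n]) (~` M `&` A n)).
    apply: bigcup_measurable => n _.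
    apply: measurableI; first exact: measurableC.
    by have [] := AN n.
  apply/seteqP; split => [t [Mt]|t [n /= xr [Mt Ant]]].
  - rewrite /= in_itv/= andbT => /rat_in_itvoo[q].
    rewrite in_itv/= => /andP[xq qh].
    have rq : r (pickle q) = ratr q by rewrite /r pickleK.
    exists (pickle q); first by rewrite /= rq.
    split=> //; have [_ _] := AN (pickle q).
    move/seteqP => [_ /(_ t)]; rewrite /= in_itv/= andbT rq => /(_ qh)[//|Nt].
    by exfalso; apply/Mt/NM; exists (pickle q).
  - split=> //=; rewrite in_itv/= andbT; apply: (lt_trans xr).
    have [_ _ /seteqP[/(_ t) + _]] := AN n.
    by rewrite /= in_itv/= andbT; apply; left.
exists M; split=> // t /= /eqP; rewrite patchE; case: ifPn => [_|].
  by rewrite eqxx.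
by rewrite notin_setE /= => /contrapT.
Qed.

(** The product measure of a null set [N] is the integral of the measures of its sections, and a
    nonnegative function with zero integral vanishes almost everywhere. *)
Lemma ae_prod d1 d2 (T1 : measurableType d1) (T2 : measurableType d2)
    (R : realType) (m1 : {sigma_finite_measure set T1 -> \bar R})
    (m2 : {sigma_finite_measure set T2 -> \bar R}) (P : T1 * T2 -> Prop) :
  {ae (m1 \x m2)%E, forall z, P z} ->
  {ae m1, forall x, {ae m2, forall y, P (x, y)}}.
Proof.
move=> [N [mN N0 PN]].
have mx := measurable_fun_xsection m2 mN.
have : ae_eq m1 setT (m2 \o xsection N) (cst 0%E).
  apply/ae_eq_integral_abs => //; rewrite -[RHS]N0 /product_measure1/=.
  by apply: eq_integral => x _; rewrite gee0_abs.
apply: filterS => x /(_ I) /= Nx0; exists (xsection N x); split => //.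
  exact: measurable_xsection.
by move=> y nP; rewrite /xsection/= inE; apply: PN.
Qed.

(** * Complex-valued measurability and integration *)

Section complex_valued.
Context d (T : measurableType d) (R : realType).
Variable mu : {measure set T -> \bar R}.
Implicit Types f g : T -> R[i].

Lemma cmeasurable_funM f g :
  cmeasurable_fun f -> cmeasurable_fun g -> cmeasurable_fun (f * g).
Proof.
move=> [rf jf] [rg jg]; split.
- rewrite (_ : (fun _ => _) = (fun x => complex.Re (f x) * complex.Re (g x)
      - complex.Im (f x) * complex.Im (g x))).
    by apply: measurable_funB; apply: measurable_funM.
  by apply/funext => x; rewrite fctE; case: (f x); case: (g x).
- rewrite (_ : (fun _ => _) = (fun x => complex.Re (f x) * complex.Im (g x)
      + complex.Im (f x) * complex.Re (g x))).
    by apply: measurable_funD; apply: measurable_funM.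
  by apply/funext => x; rewrite fctE; case: (f x); case: (g x).
Qed.

Lemma ae_cmeasurable_fun f g : measure_is_complete mu ->
  {ae mu, forall x, f x = g x} -> cmeasurable_fun f -> cmeasurable_fun g.
Proof.
move=> cmu fg [rf jf]; split; apply/measurable_EFinP.
- have := (measurable_EFinP _ _).2 rf; apply: (ae_measurable_fun cmu).
  by apply: filterS fg => x /= -> _.
- have := (measurable_EFinP _ _).2 jf; apply: (ae_measurable_fun cmu).
  by apply: filterS fg => x /= -> _.
Qed.

Lemma ae_eq_cintegral f g : cmeasurable_fun f -> cmeasurable_fun g ->
  {ae mu, forall x, f x = g x} -> cintegral mu f = cintegral mu g.
Proof.
move=> [rf jf] [rg jg] fg; rewrite /cintegral /Rintegral.
congr Complex; congr fine; apply: ae_eq_integral => //;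
  by [exact/measurable_EFinP | apply: filterS fg => x -> _].
Qed.

Lemma normc_ge0 (z : R[i]) : 0 <= normc z.
Proof. by case: z => a b; exact: sqrtr_ge0. Qed.

Lemma ler_Re_normc (z : R[i]) : `|complex.Re z| <= normc z.
Proof. by case: z => a b /=; rewrite -sqrtr_sqr ler_wsqrtr// lerDl sqr_ge0. Qed.

Lemma ler_Im_normc (z : R[i]) : `|complex.Im z| <= normc z.
Proof. by case: z => a b /=; rewrite -sqrtr_sqr ler_wsqrtr// lerDr sqr_ge0. Qed.

Lemma normc_ler (z : R[i]) : normc z <= `|complex.Re z| + `|complex.Im z|.
Proof.
case: z => a b /=; rewrite -[leRHS]ger0_norm ?addr_ge0// -sqrtr_sqr.
rewrite ler_wsqrtr// sqrrD !real_normK ?num_real// lerD2r lerDl.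
by rewrite mulrn_wge0// mulr_ge0.
Qed.

Lemma cintegrableP f : cmeasurable_fun f ->
  (\int[mu]_x (normc (f x))%:E < +oo)%E -> cintegrable mu f.
Proof.
move=> mf foo; have mn : measurable_fun setT (fun x => (normc (f x))%:E).
  exact/measurable_EFinP/measurable_normc.
have [rf jf] := mf; split; apply/integrableP; split;
  try exact/measurable_EFinP; apply: le_lt_trans foo;
  apply: ge0_le_integral => //.
- by apply: measurableT_comp => //; exact/measurable_EFinP.
- by move=> x _; rewrite lee_fin ler_Re_normc.
- by apply: measurableT_comp => //; exact/measurable_EFinP.
- by move=> x _; rewrite lee_fin ler_Im_normc.
Qed.

(** The real and imaginary parts are bounded separately, which accounts for the factor 2 in place of
    the sharp constant 1. *)
Lemma le_normc_cintegral f : cmeasurable_fun f ->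
  ((normc (cintegral mu f))%:E <= 2%:E * \int[mu]_x (normc (f x))%:E)%E.
Proof.
move=> mf; have mn : measurable_fun setT (fun x => (normc (f x))%:E).
  exact/measurable_EFinP/measurable_normc.
have [foo|] := ltP (\int[mu]_x (normc (f x))%:E)%E +oo%E; last first.
  by rewrite leye_eq => /eqP ->; rewrite gt0_muley ?leey.
have [rf jf] := mf; have [irf ijf] := cintegrableP mf foo.
apply: (@le_trans _ _ (`|\int[mu]_x complex.Re (f x)|%:E
                       + `|\int[mu]_x complex.Im (f x)|%:E)%E).
  by rewrite -EFinD lee_fin normc_ler.
rewrite mule_natl mule2n /Rintegral; apply: leeD.
- rewrite -abse_EFin fineK ?integrable_fin_num//.
  apply: (le_trans (le_abse_integral _ _ _)) => //.
    exact/measurable_EFinP.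
  apply: ge0_le_integral => //.
  + by apply: measurableT_comp => //; exact/measurable_EFinP.
  + by move=> x _; rewrite lee_fin ler_Re_normc.
- rewrite -abse_EFin fineK ?integrable_fin_num//.
  apply: (le_trans (le_abse_integral _ _ _)) => //.
    exact/measurable_EFinP.
  apply: ge0_le_integral => //.
  + by apply: measurableT_comp => //; exact/measurable_EFinP.
  + by move=> x _; rewrite lee_fin ler_Im_normc.
Qed.

End complex_valued.

(** * Measurability of kernel sections and of the integral operator *)

Section kernel_measurability.
Context d1 d2 (T1 : measurableType d1) (T2 : measurableType d2) (R : realType).
Variables (mu1 : {sigma_finite_measure set T1 -> \bar R}).
Variables (mu2 : {sigma_finite_measure set T2 -> \bar R}).

(** Tonelli's theorem makes the integrals of the positive and negative parts measurable in [x]. The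
    real integral is [fine] of their difference at every [x], with value 0 where that difference is
    infinite. *)
Lemma measurable_Rintegral_prod (h : T1 * T2 -> R) :
  measurable_fun [set: T1 * T2] h ->
  measurable_fun [set: T1] (fun x => \int[mu2]_y h (x, y)).
Proof.
move=> mh; have mEh : measurable_fun setT (EFin \o h) by exact/measurable_EFinP.
rewrite (_ : (fun _ => _) = fine \o fun x => (fubini_F mu2 (EFin \o h)^\+ x -
    fubini_F mu2 (EFin \o h)^\- x)%E); last first.
  apply/funext => x; rewrite /= /Rintegral integralE /fubini_F.
  by congr (fine (_ - _)); apply: eq_integral => y _;
    rewrite ?funeposE ?funenegE.
have mfine : measurable_fun [set: \bar R] (@fine R) by exact: fine_measurable.
apply: (measurableT_comp mfine).
apply: emeasurable_funB; apply: measurable_fun_fubini_tonelli_F => //.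
- exact: measurable_funepos.
- exact: measurable_funeneg.
Qed.

Lemma cmeasurable_cintegral_prod (h : T1 * T2 -> R[i]) :
  cmeasurable_fun h ->
  cmeasurable_fun (fun x => cintegral mu2 (fun y => h (x, y))).
Proof.
move=> [rh jh]; split.
- exact: (measurable_Rintegral_prod rh).
- exact: (measurable_Rintegral_prod jh).
Qed.

Hypotheses (cmu1 : measure_is_complete mu1) (cmu2 : measure_is_complete mu2).
Variable K : T1 -> T2 -> R[i].
Hypothesis mK : forall B : set R, measurable B ->
  completed_algebra_gen (mu1 \x mu2)%E
    [set z | B (complex.Re (K z.1 z.2))] /\
  completed_algebra_gen (mu1 \x mu2)%E
    [set z | B (complex.Im (K z.1 z.2))].

(** Real and imaginary parts are corrected separately, and the exceptional null sets of the product
    are then cut into sections. *)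
Lemma completed_kernel_ae : exists2 K' : T1 * T2 -> R[i], cmeasurable_fun K' &
  {ae mu1, forall x, {ae mu2, forall y, K' (x, y) = K x y}}.
Proof.
have [kr mkr krE] := completed_measurable_fun_ae
  (h := fun z => complex.Re (K z.1 z.2)) (fun B mB => (mK mB).1).
have [ki mki kiE] := completed_measurable_fun_ae
  (h := fun z => complex.Im (K z.1 z.2)) (fun B mB => (mK mB).2).
exists (fun z => Complex (kr z) (ki z)) => //.
have := ae_prod krE; have := ae_prod kiE.
apply: filterS2 => x; apply: filterS2 => y /= -> ->.
by case: (K x y).
Qed.

(** For the product-measurable [K'] every section is measurable, and so is the integral as a
    function of [x]. Completeness of [mu2] carries this over to almost every section of [K];
    completeness of [mu1] does so for the integral, which changes only on a null set of [x]. *)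
Lemma kernel_sections_cmeasurable (f : T2 -> R[i]) : cmeasurable_fun f ->
  {ae mu1, forall x, cmeasurable_fun (fun y => K x y * f y)} /\
  cmeasurable_fun (fun x => cintegral mu2 (fun y => K x y * f y)).
Proof.
move=> mf; have [K' mK' K'E] := completed_kernel_ae.
have mh : cmeasurable_fun (fun z : T1 * T2 => K' z * f z.2).
  apply: cmeasurable_funM => //; have [rf jf] := mf.
  split; first exact: (measurableT_comp rf measurable_snd).
  exact: (measurableT_comp jf measurable_snd).
have mhx x : cmeasurable_fun (fun y => K' (x, y) * f y).
  have [rh jh] := mh; split.
  - exact: (measurableT_comp rh (pair1_measurable x)).
  - exact: (measurableT_comp jh (pair1_measurable x)).
have mKx : {ae mu1, forall x, cmeasurable_fun (fun y => K x y * f y) /\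
    {ae mu2, forall y, K' (x, y) * f y = K x y * f y}}.
  apply: filterS K'E => x K'x.
  have aex : {ae mu2, forall y, K' (x, y) * f y = K x y * f y}.
    by apply: filterS K'x => y ->.
  by split => //; exact: (ae_cmeasurable_fun cmu2 aex).
split; first by apply: filterS mKx => x [].
apply: (ae_cmeasurable_fun cmu1 _ (cmeasurable_cintegral_prod mh)).
by apply: filterS mKx => x [mx aex]; exact: ae_eq_cintegral.
Qed.

End kernel_measurability.

(** * Weighted Hölder inequality and linearity *)

(** Hölder's inequality for the splitting of [b |f|] into [|f| w^(1/p)] and [b w^(-1/p)]: the
    [p]-norm of the first factor is the weighted norm of [f]. *)
Lemma hoelder_wnorm d (T : measurableType d) (R : realType)
    (mu : {measure set T -> \bar R}) (w b : T -> R) (p q : R) (f : T -> R[i]) :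
  measurable_fun [set: T] w -> (forall x, 0 < w x) ->
  measurable_fun [set: T] b -> (forall x, 0 <= b x) ->
  0 < p -> 0 < q -> p^-1 + q^-1 = 1 -> cmeasurable_fun f ->
  (\int[mu]_x (b x * normc (f x))%:E <=
   wnorm mu w p f * 'N[mu]_q%:E[EFin \o (fun x => b x * w x `^ (- p^-1))%R])%E.
Proof.
move=> mw w0 mb b0 p0 q0 pq mf.
have mwp r : measurable_fun setT (fun x => w x `^ r).
  exact: (measurableT_comp (measurable_powR _)).
have mn := measurable_normc mf.
have := @hoelder _ _ _ mu (fun x => normc (f x) * w x `^ p^-1)
  (fun x => b x * w x `^ (- p^-1)) p q.
move=> /(_ (measurable_funM mn (mwp _)) (measurable_funM mb (mwp _)) p0 q0 pq).
rewrite Lnorm1 => h; apply: (le_trans _ (le_trans h _)).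
  rewrite le_eqVlt; apply/orP; left; apply/eqP; apply: eq_integral => x _ /=.
  rewrite mulrACA -powRD ?subrr ?powRr0 ?mulr1; last first.
    by rewrite (gt_eqF (w0 x)) implybT.
  by rewrite ger0_norm 1?mulrC// mulr_ge0// normc_ge0.
rewrite lee_wpmul2r ?Lnorm_ge0// unlock /wnorm le_eqVlt; apply/orP; left.
apply/eqP; congr poweR; apply: eq_integral => x _ /=.
rewrite ger0_norm ?mulr_ge0 ?normc_ge0 ?powR_ge0// powRM ?normc_ge0 ?powR_ge0//.
by rewrite -powRrM mulVf ?gt_eqF// powRr1// ltW.
Qed.

Lemma cintegral_linear d (T : measurableType d) (R : realType)
    (mu : {measure set T -> \bar R}) (c : R[i]) (f g : T -> R[i]) :
  cintegrable mu f -> cintegrable mu g ->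
  cintegral mu (c *: f + g) = c * cintegral mu f + cintegral mu g.
Proof.
case: c => a b [rf jf] [rg jg].
have iZ r (h : T -> R) : mu.-integrable setT (EFin \o h) ->
    mu.-integrable setT (EFin \o (fun x => r * h x)).
  by move=> ih; exact: (integrableZl measurableT r ih).
have iB (h k : T -> R) : mu.-integrable setT (EFin \o h) ->
    mu.-integrable setT (EFin \o k) ->
    mu.-integrable setT (EFin \o (fun x => h x - k x)).
  by move=> ih ik; exact: (integrableB measurableT ih ik).
have iD (h k : T -> R) : mu.-integrable setT (EFin \o h) ->
    mu.-integrable setT (EFin \o k) ->
    mu.-integrable setT (EFin \o (fun x => h x + k x)).
  by move=> ih ik; exact: (integrableD measurableT ih ik).
have [Zrf Zjf] := (iZ a _ rf, iZ b _ jf).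
have [Zjf' Zrf'] := (iZ a _ jf, iZ b _ rf).
rewrite /cintegral.
(* Multiplication by [a + ib] mixes the two parts of [f]; once they are expanded, only linearity of
   the real integral is left. *)
transitivity (Complex
  (\int[mu]_x (a * complex.Re (f x) - b * complex.Im (f x) + complex.Re (g x)))
  (\int[mu]_x (a * complex.Im (f x) + b * complex.Re (f x) + complex.Im (g x)))).
  congr Complex; apply: eq_Rintegral => x _; rewrite !fctE;
    by case: (f x) => u v; case: (g x) => s t.
rewrite RintegralD//; last exact: iB.
rewrite [X in Complex _ X]RintegralD//; last exact: iD.
by rewrite RintegralB// [X in Complex _ (X + _)]RintegralD// !RintegralZl.
Qed.

(** Serves maps built inside a proof, such as one depending on a choice of representatives, whose
    linear structure has to be packed on the spot. *)
Lemma linear_bundle (K : pzRingType) (U V : lmodType K) (T : U -> V) :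
  linear T -> exists T' : {linear U -> V}, T' =1 T.
Proof.
move=> lT; pose T' : {linear U -> V} :=
  HB.pack T (GRing.isLinear.Build K U V *:%R T lT).
by exists T'.
Qed.

Lemma wLclass_surj d (T : measurableType d) (R : realType)
    (mu : {measure set T -> \bar R}) (w : T -> R) (p : R)
    (mw : measurable_fun [set: T] w) (w0 : forall x, 0 < w x) (p1 : 1 < p)
    (u : wLspace mu mw w0 p1) :
  exists f : wLfunType mu mw w0 p1, wLclass f = u.
Proof. by elim/quotW: u => f; exists f. Qed.

(** * The operator of a kernel dominated by a rank-one kernel *)

Section dominated_kernel.
Context d1 d2 (T1 : measurableType d1) (T2 : measurableType d2) (R : realType).
Variables (mu1 : {sigma_finite_measure set T1 -> \bar R}).
Variables (mu2 : {sigma_finite_measure set T2 -> \bar R}).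
Hypotheses (cmu1 : measure_is_complete mu1) (cmu2 : measure_is_complete mu2).
Variable K : T1 -> T2 -> R[i].
Hypothesis mK : forall B : set R, measurable B ->
  completed_algebra_gen (mu1 \x mu2)%E
    [set z | B (complex.Re (K z.1 z.2))] /\
  completed_algebra_gen (mu1 \x mu2)%E
    [set z | B (complex.Im (K z.1 z.2))].
Variables (w1 : T2 -> R) (w2 : T1 -> R) (p1 p2 q1 : R).
Hypotheses (mw1 : measurable_fun [set: T2] w1) (w1_gt0 : forall y, 0 < w1 y).
Hypotheses (mw2 : measurable_fun [set: T1] w2) (w2_gt0 : forall x, 0 < w2 x).
Hypotheses (hp1 : 1 < p1) (hp2 : 1 < p2).
Hypotheses (q1_gt0 : 0 < q1) (pq1 : p1^-1 + q1^-1 = 1).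
Variables (a : T1 -> R) (b : T2 -> R).
Hypotheses (ma : measurable_fun [set: T1] a) (a_ge0 : forall x, 0 <= a x).
Hypotheses (mb : measurable_fun [set: T2] b) (b_ge0 : forall y, 0 <= b y).
Hypothesis Kab : forall x y, normc (K x y) <= a x * b y.
Hypothesis a_fin : (\int[mu1]_x (a x `^ p2 * w2 x)%:E < +oo)%E.
Hypothesis b_fin :
  ('N[mu2]_q1%:E[EFin \o (fun y => b y * w1 y `^ (- p1^-1))%R] < +oo)%E.

Local Notation op f := (fun x => cintegral mu2 (fun y => K x y * f y)).
Local Notation L1 := (wLfunType mu2 mw1 w1_gt0 hp1).
Local Notation L2 := (wLfunType mu1 mw2 w2_gt0 hp2).

(** [A] is the norm of [a] in the target space and [B] the norm of [b] dual to that of the source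
    space; the operator bound will be [2 * A * B]. *)
Let A : R := fine ((\int[mu1]_x (a x `^ p2 * w2 x)%:E) `^ p2^-1)%E.
Let B : R :=
  fine ('N[mu2]_q1%:E[EFin \o (fun y => b y * w1 y `^ (- p1^-1))%R])%E.

Let B_ge0 : 0 <= B. Proof. by rewrite fine_ge0// Lnorm_ge0. Qed.

Let AE : (A%:E = (\int[mu1]_x (a x `^ p2 * w2 x)%:E) `^ p2^-1)%E.
Proof. by rewrite fineK// ge0_fin_numE ?poweR_ge0//; exact: poweR_lty. Qed.

Let BE : (B%:E = 'N[mu2]_q1%:E[EFin \o (fun y => b y * w1 y `^ (- p1^-1))%R])%E.
Proof. by rewrite fineK// ge0_fin_numE ?Lnorm_ge0. Qed.

(** Domination pulls [a x] out of the integral, and Hölder bounds what remains by [B] times the norm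
    of [f]. An exceptional null set appears because only almost every section of [K] is known to be
    measurable; the 2 comes from [le_normc_cintegral]. *)
Lemma dominated_kernel_section (f : L1) :
  {ae mu1, forall x, cintegrable mu2 (fun y => K x y * f y) /\
    normc (op f x) <= 2 * (a x * (fine (wnorm mu2 w1 p1 f) * B))}.
Proof.
have [mf ff] := wLfun_valP f; have nf := wnorm_fin f.
have [+ _] := kernel_sections_cmeasurable cmu1 cmu2 mK mf.
apply: filterS => x mKf.
have mbf : measurable_fun setT (fun y => b y * normc (f y)).
  by apply: measurable_funM => //; exact: measurable_normc.
have p1_gt0 : 0 < p1 by exact: lt_trans hp1.
have bd : (\int[mu2]_y (normc (K x y * f y))%:E
    <= (a x * (fine (wnorm mu2 w1 p1 f) * B))%:E)%E.
  apply: (@le_trans _ _ (\int[mu2]_y ((a x)%:E * (b y * normc (f y))%:E))%E).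
    apply: ge0_le_integral => //.
    - by move=> y _; rewrite lee_fin normc_ge0.
    - exact/measurable_EFinP/measurable_normc.
    - by apply/measurable_EFinP; exact: measurable_funM.
    - by move=> y _; rewrite lee_fin normcM mulrA ler_wpM2r ?normc_ge0.
  rewrite ge0_integralZl//; last 3 first.
  - exact/measurable_EFinP.
  - by move=> y _; rewrite lee_fin mulr_ge0 ?normc_ge0.
  - by rewrite lee_fin.
  rewrite !EFinM fineK// BE lee_wpmul2l ?lee_fin//.
  exact: hoelder_wnorm.
split; first by apply: cintegrableP => //; exact: le_lt_trans bd (ltry _).
rewrite -lee_fin EFinM; apply: (le_trans (le_normc_cintegral mu2 mKf)).
by rewrite lee_wpmul2l.
Qed.

(** The pointwise bound is a constant multiple of [a], so its weighted norm is that constant times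
    [A]. *)
Lemma wnorm_dominated_kernel (f : L1) :
  (wnorm mu1 w2 p2 (op f) <= (2 * A * B * fine (wnorm mu2 w1 p1 f))%:E)%E.
Proof.
have p2_gt0 : 0 < p2 by exact: lt_trans hp2.
have [mf _] := wLfun_valP f.
have [_ mop] := kernel_sections_cmeasurable cmu1 cmu2 mK mf.
set N := fine _; have N_ge0 : 0 <= N by rewrite fine_ge0// wnorm_ge0.
have c_ge0 : 0 <= 2 * B * N by rewrite !mulr_ge0.
have mpow (h : T1 -> R) r : measurable_fun setT h ->
    measurable_fun setT (fun x => h x `^ r).
  exact: (measurableT_comp (measurable_powR _)).
have maw : measurable_fun setT (fun x => (a x `^ p2 * w2 x)%:E).
  by apply/measurable_EFinP; apply: measurable_funM => //; exact: mpow.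
have aw_ge0 x : (0 <= (a x `^ p2 * w2 x)%:E)%E.
  by rewrite lee_fin mulr_ge0 ?powR_ge0// ltW.
apply: (@le_trans _ _
    ((((2 * B * N) `^ p2)%:E * \int[mu1]_x (a x `^ p2 * w2 x)%:E) `^ p2^-1)%E).
  rewrite /wnorm; apply: gt0_ler_poweR.
  - by rewrite invr_ge0 ltW.
  - rewrite in_itv/= leey andbT integral_ge0// => x _.
    by rewrite lee_fin mulr_ge0 ?powR_ge0// ltW.
  - by rewrite in_itv/= leey andbT mule_ge0 ?lee_fin ?powR_ge0 ?integral_ge0.
  rewrite -ge0_integralZl ?lee_fin ?powR_ge0//.
  apply: ae_ge0_le_integral => //.
  - by move=> x _; rewrite lee_fin mulr_ge0 ?powR_ge0// ltW.
  - apply/measurable_EFinP; apply: measurable_funM => //; apply: mpow.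
    exact: measurable_normc.
  - by move=> x _; rewrite mule_ge0// lee_fin powR_ge0.
  - by apply: measurable_funeM.
  apply: filterS (dominated_kernel_section f) => x [_ le_op] _.
  rewrite lee_fin mulrA ler_wpM2r ?(ltW (w2_gt0 _))// -powRM//.
  rewrite ge0_ler_powR ?(ltW p2_gt0) ?nnegrE ?normc_ge0 ?mulr_ge0//.
  apply: (le_trans le_op); rewrite -/N le_eqVlt; apply/orP; left.
  by apply/eqP; ring.
rewrite poweRM ?lee_fin ?powR_ge0 ?integral_ge0// -AE poweR_EFin -EFinM.
rewrite -powRrM mulfV ?gt_eqF// powRr1// lee_fin.
by rewrite le_eqVlt; apply/orP; left; apply/eqP; ring.
Qed.

Lemma dominated_kernel_wLfun (f : L1) : op f \in wLfun_of mu1 mw2 w2_gt0 hp2.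
Proof.
apply/wLfunP; split; last first.
  exact: le_lt_trans (wnorm_dominated_kernel f) (ltry _).
have [mf _] := wLfun_valP f.
by have [] := kernel_sections_cmeasurable cmu1 cmu2 mK mf.
Qed.

Theorem dominated_kernel_operator :
  exists T : {linear wLspace mu2 mw1 w1_gt0 hp1 -> wLspace mu1 mw2 w2_gt0 hp2},
    (forall (f : T2 -> R[i]) (u : wLspace mu2 mw1 w1_gt0 hp1),
       represents f u ->
       {ae mu1, forall x, cintegrable mu2 (fun y => K x y * f y)} /\
       represents (op f) (T u)) /\
    exists M : R, forall u, `|T u| <= M * `|u|.
Proof.
(* [r] picks a representative of each class. The operator on classes is the class of [opL] at that
   representative, and [op_class] makes it independent of the choice. *)
have [r rE] := choice (@wLclass_surj _ _ _ mu2 w1 p1 mw1 w1_gt0 hp1).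
pose opL (f : L1) : L2 := WLfun (dominated_kernel_wLfun f).
have op_class (f g : L1) : wLclass f = wLclass g ->
    wLclass (opL f) = wLclass (opL g).
  move=> /wLclass_eqP fg; apply/wLclass_eqP.
  have [mf _] := wLfun_valP f; have [mg _] := wLfun_valP g.
  have [mKf _] := kernel_sections_cmeasurable cmu1 cmu2 mK mf.
  have [mKg _] := kernel_sections_cmeasurable cmu1 cmu2 mK mg.
  apply: filterS2 mKf mKg => x mKf mKg; apply: ae_eq_cintegral => //.
  by apply: filterS fg => y ->.
have lin : linear (fun u => wLclass (opL (r u))).
  move=> c u v; rewrite -wLclassZ -wLclassD.
  (* The two arguments of [opL] may differ pointwise but lie in one class. For the second, linearity
     of the integral applies at every [x] where both sections are integrable, hence almost
     everywhere. *)
  rewrite (_ : wLclass (opL (r (c *: u + v))) = wLclass (opL (c *: r u + r v))).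
    apply/wLclass_eqP.
    apply: filterS2 (dominated_kernel_section (r u))
      (dominated_kernel_section (r v)) => x [iu _] [iv _].
    rewrite -[RHS]/(c * cintegral mu2 (fun y => K x y * r u y) +
      cintegral mu2 (fun y => K x y * r v y)) -cintegral_linear//.
    congr cintegral; apply/funext => y.
    rewrite -[LHS]/(K x y * (c * r u y + r v y)).
    rewrite -[RHS]/(c * (K x y * r u y) + K x y * r v y).
    by rewrite mulrDr mulrCA.
  by apply: op_class; rewrite wLclassD wLclassZ !rE.
have [T TE] := linear_bundle lin; exists T; split.
  move=> _ u [f <- fu]; split.
    by apply: filterS (dominated_kernel_section f) => x [].
  by exists (opL f) => //; rewrite TE; apply: op_class; rewrite rE.
exists (2 * A * B) => u; rewrite TE.
rewrite -[X in _ <= _ * `|X|]rE.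
rewrite [X in X <= _]wLspace_norm_class.
rewrite [X in _ <= _ * X]wLspace_norm_class.
rewrite -lee_fin fineK ?(wnorm_fin (opL (r u)))//.
exact: wnorm_dominated_kernel.
Qed.

End dominated_kernel.

(** * Integrability of powers of [1 + |x|] *)

Lemma ler_powRN (R : realType) (r : R) : 0 <= r ->
  {in Num.pos &, {homo (fun x => x `^ (- r)) : x y /~ x <= y}}.
Proof.
move=> r0 x y; rewrite !posrE => x0 y0 xy; rewrite !powRN.
rewrite lef_pV2 ?posrE ?powR_gt0//.
by apply: ge0_ler_powR => //; rewrite nnegrE ltW.
Qed.

Lemma is_derive_powR1D (R : realType) (r x : R) : -1 < x ->
  is_derive x 1 (fun y => (1 + y) `^ r) (r * (1 + x) `^ (r - 1)).
Proof.
move=> x1; have d1 : is_derive x 1 (fun y : R => 1 + y) 1.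
  by rewrite -[X in is_derive _ _ _ X]add0r; exact: is_deriveD.
have x1_gt0 : 0 < 1 + x by lra.
have d2 := is_derive1_powR r x1_gt0.
by have := is_derive1_comp d2 d1; rewrite mulr1.
Qed.

Lemma cvg_powR1D (R : realType) (r : R) : 0 < r ->
  (1 + x) `^ (- r) @[x --> +oo%R] --> (0 : R).
Proof.
move=> r0; apply/cvgrPdist_le => e e0; near=> x.
(* The threshold is the solution of [x^(-r) = e]. *)
have x0 : e `^ (- r^-1) <= x by near: x; exact: nbhs_pinfty_ge.
have e1 : 0 < e `^ (- r^-1) by exact: powR_gt0.
rewrite sub0r normrN ger0_norm ?powR_ge0//.
apply: (@le_trans _ _ ((e `^ (- r^-1)) `^ (- r))).
  by apply: ler_powRN; rewrite ?posrE ?(ltW r0)//; lra.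
by rewrite -powRrM mulrNN mulVf ?gt_eqF// powRr1// ltW.
Unshelve. all: by end_near. Qed.

(** The integrand is even, so the half-line suffices. There [F] is an antiderivative, and it tends
    to 0 at infinity because [1 - t < 0]. *)
Lemma lebesgue_integral_powR1D (R : realType) (t : R) : 1 < t ->
  (\int[lebesgue_measure]_x ((1 + `|x|) `^ (- t))%:E < +oo :> \bar R)%E.
Proof.
move=> t1; pose F (x : R) : R := (1 - t)^-1 * (1 + x) `^ (1 - t).
have t1_neq0 : 1 - t != 0 by rewrite subr_eq0 lt_eqF.
have dF (x : R) : -1 < x -> is_derive x 1 F ((1 + x) `^ (- t)).
  move=> x1; have d := is_derive_powR1D (1 - t) x1.
  have := is_deriveZ ((1 - t)^-1) d.
  by rewrite -[_ *: _]/(_ * _) mulKf// addrAC subrr add0r.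
have cF (x : R) : -1 < x -> {for x, continuous F}.
  move=> /dF[dFx _]; apply: differentiable_continuous.
  exact/derivable1_diffP.
have cf : continuous (fun x : R => (1 + `|x|) `^ (- t)).
  move=> x; have x1 : -1 < `|x| by exact: lt_le_trans (normr_ge0 x).
  have [dfx _] := is_derive_powR1D (- t) x1.
  have cn : {for x, continuous (fun y : R => `|y|)} by exact: norm_continuous.
  have cg : {for `|x|, continuous (fun y : R => (1 + y) `^ (- t))}.
    by apply: differentiable_continuous; exact/derivable1_diffP.
  exact: (continuous_comp cn cg).
rewrite ge0_symfun_integralT//; last first.
  by move=> x /=; rewrite normrN.
rewrite -set_itvcy (@ge0_continuous_FTC2y _ _ F _ 0).
- by apply: lte_mul_pinfty => //; rewrite -EFinB ltry.
- by move=> x _; exact: powR_ge0.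
- exact: continuous_subspaceT.
- rewrite -[X in _ --> X](mulr0 (1 - t)^-1); apply: cvgMr.
  by rewrite -opprB; apply: cvg_powR1D; rewrite subr_gt0.
- by move=> x x0; have [] := dF x (lt_trans (ltrN10 _) x0).
- by apply: cvg_at_right_filter; apply: cF; lra.
- move=> x; rewrite in_itv/= andbT => x0; have x1 : -1 < x by lra.
  by have [_ dE] := dF x x1; rewrite derive1E dE gtr0_norm.
Qed.

Lemma leb_measurable_id (R : realType) :
  measurable_fun [set: lebesgueType R]
    (id : lebesgueType R -> measurableTypeR R).
Proof. by move=> _ B mB; rewrite setTI; exact: sub_caratheodory. Qed.

(** [lebesgue_measure] lives on the Borel sets and [leb] on their completion. The former is by
    computation the image of the latter under the identity, so a change of variables transfers the
    integral. *)
Lemma leb_integralE (R : realType) (f : R -> R) :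
  measurable_fun [set: measurableTypeR R] f -> (forall x, 0 <= f x) ->
  (\int[leb]_x (f (x : lebesgueType R))%:E =
   \int[lebesgue_measure]_x (f x)%:E :> \bar R)%E.
Proof.
move=> mf f0; transitivity (\int[pushforward (@leb R)
    (id : lebesgueType R -> measurableTypeR R)]_x (f x)%:E)%E.
  rewrite (ge0_integral_pushforward (@leb_measurable_id R))//.
  - exact/measurable_EFinP.
  - by move=> x _; rewrite lee_fin.
reflexivity.
Qed.

Lemma leb_integral_powR1D (R : realType) (t : R) : 1 < t ->
  (\int[leb]_x ((1 + `|x : R|) `^ (- t))%:E < +oo :> \bar R)%E.
Proof.
move=> t1; rewrite (@leb_integralE _ (fun x => (1 + `|x|) `^ (- t))).
- exact: lebesgue_integral_powR1D.
- apply: (measurableT_comp (measurable_powR _)).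
  by apply: measurable_funD => //; exact: normr_measurable.
- by move=> x; exact: powR_ge0.
Qed.

(** * Splitting of the kernel and choice of the exponents *)

(** The base [1 + |x| + |y|] dominates both [1 + |x|] and [1 + |y|], and a nonpositive power
    reverses the comparison. *)
Lemma kernel_exponent_split (R : realType) (alpha beta x y : R) :
  0 <= alpha -> 0 <= beta ->
  (1 + `|x| + `|y|) `^ (- (alpha + beta)) <=
  (1 + `|x|) `^ (- alpha) * (1 + `|y|) `^ (- beta).
Proof.
move=> al0 be0; have [x0 y0] := (normr_ge0 x, normr_ge0 y).
rewrite opprD powRD; last by apply/implyP => _; rewrite gt_eqF//; lra.
by apply: ler_pM; rewrite ?powR_ge0//; apply: ler_powRN; rewrite ?posrE//; lra.
Qed.

Theorem theorem3 (R : realType) (kappa s1 s2 p1 p2 q1 : R)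
    (hp1 : 1 < p1) (hp2 : 1 < p2) (K : R -> R -> R[i]) :
  1 / p1 + 1 / q1 = 1 ->
  lebesgue_measurable_kernel K ->
  kernel_sim K kappa ->
  s1 < 0 ->
  Num.max (1 / q1 - 2 * s1 / p1)
          (1 / p2 + 1 / q1 + 2 * s2 / p2 - 2 * s1 / p1) < kappa ->
  exists T : {linear Hspace hp1 s1 -> Hspace hp2 s2},
    (forall (f : lebesgueType R -> R[i]) (u : Hspace hp1 s1),
       represents f u ->
       {ae leb, forall x : lebesgueType R,
          cintegrable leb (fun y : lebesgueType R => K x y * f y)} /\
       represents (integral_operator K f) (T u)) /\
    exists M : R, forall u : Hspace hp1 s1, `|T u| <= M * `|u|.
Proof.
move=> pq1 mK [c1 [c2 [_ c2_gt0 Kc]]] s1_lt0; rewrite gt_max => /andP[k1 k2].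
have p1_gt0 : 0 < p1 by exact: lt_trans hp1.
have p2_gt0 : 0 < p2 by exact: lt_trans hp2.
have p1V : 0 < p1^-1 by rewrite invr_gt0.
have p1V1 : p1^-1 < 1 by rewrite invf_lt1.
rewrite !div1r in pq1 k1 k2.
(* Positivity of [q1] comes from the conjugacy relation and [1 / p1 < 1]. *)
have q1V : 0 < q1^-1 by lra.
have q1_gt0 : 0 < q1 by rewrite -invr_gt0.
have s1p1 : s1 / p1 < 0 by rewrite pmulr_llt0.
rewrite -!mulrA in k1 k2.
pose a := kappa + 2 * (s1 / p1).
pose m := Num.min a (a - p2^-1 - 2 * (s2 / p2)).
(* The two lower bounds on [kappa] say exactly that [1 / q1] lies below each term of the minimum, so
   the midpoint [b] is an admissible choice. *)
have q1m : q1^-1 < m by rewrite lt_min; apply/andP; split; rewrite /a; lra.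
pose b := (q1^-1 + m) / 2.
have [ma1 ma2] : m <= a /\ m <= a - p2^-1 - 2 * (s2 / p2).
  by rewrite /m !ge_min !lexx orbT.
have b1 : q1^-1 < b by rewrite /b; lra.
have b2 : b < m by rewrite /b; lra.
pose alpha := a - b; pose beta := b - 2 * (s1 / p1).
(* [alpha] is nonnegative because [b < m <= a], and [beta] because [b > 1 / q1 > 0] and [s1 < 0]. *)
have al0 : 0 <= alpha by rewrite /alpha; lra.
have be0 : 0 <= beta by rewrite /beta; lra.
have kE : kappa = alpha + beta by rewrite /alpha /beta /a; ring.
have norm0 (x : R) : 0 < 1 + `|x| by rewrite ltr_pwDl.
have mpow r : measurable_fun [set: lebesgueType R]
    (fun x : lebesgueType R => (1 + `|x : R|) `^ r).
  (* The exponent of the weight is twice its parameter, hence [r / 2]. *)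
  rewrite [X in measurable_fun _ X](_ : _ = (@Hweight R (r / 2))).
    exact: measurable_Hweight.
  by apply/funext => x; rewrite /Hweight mulrC divfK.
apply: (@dominated_kernel_operator _ _ _ _ R leb leb
  completed_lebesgue_measure_is_complete completed_lebesgue_measure_is_complete
  K mK _ _ p1 p2 q1 _ _ _ _ hp1 hp2 q1_gt0 pq1
  (fun x => c2 * (1 + `|x : R|) `^ (- alpha))
  (fun y => (1 + `|y : R|) `^ (- beta))).
- by apply: measurable_funM => //; exact: measurable_cst.
- by move=> x; rewrite mulr_ge0 ?powR_ge0// ltW.
- exact: mpow.
- by move=> y; exact: powR_ge0.
- move=> x y; apply: (le_trans (Kc x y).2).
  rewrite -mulrA ler_wpM2l ?(ltW c2_gt0)//.
  by rewrite kE; exact: kernel_exponent_split.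
- under eq_integral => x _.
    rewrite powRM ?powR_ge0 ?(ltW c2_gt0)// /Hweight -powRrM -mulrA.
    rewrite -powRD; last first.
      by apply/implyP => _; rewrite gt_eqF.
    rewrite EFinM (_ : - alpha * p2 + 2 * s2 = - (alpha * p2 - 2 * s2));
      last by ring.
    over.
  rewrite ge0_integralZl//; last 2 first.
  + exact/measurable_EFinP.
  + by rewrite lee_fin powR_ge0.
  apply: lte_mul_pinfty; rewrite ?lee_fin ?powR_ge0//.
  apply: leb_integral_powR1D.
  (* This is [b < m] for the second term of the minimum; multiplied by [p2] it becomes
     [alpha * p2 - 2 * s2 > 1]. *)
  have al2 : p2^-1 + 2 * (s2 / p2) < alpha by rewrite /alpha; lra.
  have := ltr_pM2r p2_gt0 (p2^-1 + 2 * (s2 / p2)) alpha; rewrite al2 => al2p.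
  have e1 : p2^-1 * p2 = 1 by rewrite mulVf ?gt_eqF.
  have e2 : s2 / p2 * p2 = s2 by rewrite divfK ?gt_eqF.
  by nra.
- rewrite unlock; apply: poweR_lty.
  under eq_integral => y _.
    rewrite /= /Hweight -powRrM -powRD; last first.
      by apply/implyP => _; rewrite gt_eqF.
    rewrite ger0_norm ?powR_ge0// -powRrM.
    (* The term [- 2 * (s1 / p1)] of [beta] was chosen to cancel the weight, so integrability only
       requires [b * q1 > 1]. *)
    rewrite (_ : (_ + _) * q1 = - (b * q1)); last by rewrite /beta; ring.
    over.
  apply: leb_integral_powR1D.
  by rewrite -(ltr_pM2r q1_gt0) mulVf ?gt_eqF// in b1.
Qed.
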